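(* Let $0<q<1$ and let $a$ satisfy $q\le a<1$. For $m\in\mathbb{Z}$ put $y_m=a^{-2}q^{-2m}+a^2q^{2m}$. Then for all nonnegative integers $k,k'$, $$\sum_{m=-\infty}^{\infty}a^{4m+1}q^{2m^2}\big(a^{-1}q^{-m}+aq^{m}\big)\,D_k^{(q^{-1})}(y_m|q)\,D_{k'}^{(q^{-1})}(y_m|q)=\frac{(-a^2;q)_\infty\,(-q/a^2;q)_\infty\,(q;q)_\infty\,(q;q)_{2k}}{q^{k}\,\big((q;q^2)_k\big)^{2}}\;\delta_{kk'}.$$
   Context: Notation: $(a;p)_n=\prod_{j=0}^{n-1}(1-ap^j)$ with $(a;p)_0=1$, $(a;p)_\infty=\prod_{j=0}^{\infty}(1-ap^j)$, and $\delta_{kk'}$ is the Kronecker delta. The dual discrete $q$-ultraspherical polynomials with parameter $s>0$ are the polynomials $D_n^{(s)}(y|q)$ in $y$ such that, with $\mu(x;s)=q^{-x}+sq^{x+1}$, $$D_n^{(s)}(\mu(x;s)|q)={}_3\phi_2\big(q^{-x},\,sq^{x+1},\,q^{-n};\ \sqrt{s}\,q,\,-\sqrt{s}\,q;\ q,\,-q^{n+1}\big),$$ where ${}_3\phi_2(a_1,a_2,a_3;b_1,b_2;q,z)=\sum_{k\ge 0}\frac{(a_1;q)_k(a_2;q)_k(a_3;q)_k}{(b_1;q)_k(b_2;q)_k}\frac{z^k}{(q;q)_k}$. Explicitly, as a polynomial in $y$, $$D_n^{(s)}(y|q)=\sum_{k=0}^n\frac{(q^{-n};q)_k\,\prod_{j=0}^{k-1}\big(1+sq^{2j+1}-q^j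 y\big)}{(sq^2;q^2)_k\,(q;q)_k}\,(-q^{n+1})^k .$$ Here $s=q^{-1}$ is used. *)

(* Defs.v *)
From HB Require Import structures.
From mathcomp Require Import all_boot all_order all_algebra.
From mathcomp Require Import all_classical all_reals all_analysis.
From mathcomp Require Import ring.
Set Implicit Arguments.
Unset Strict Implicit.
Unset Printing Implicit Defensive.
Import Order.TTheory GRing.Theory Num.Theory.
Import numFieldNormedType.Exports.
Local Open Scope classical_set_scope.
Local Open Scope ring_scope.

Definition qpoch (R : realType) (a p : R) (n : nat) : R :=
  \prod_(j < n) (1 - a * p ^+ j).

(* Meaningful for `|p| < 1, where the partial products converge. *)
Definition qpoch_inf (R : realType) (a p : R) : R :=
  limn (fun n => qpoch a p n).

Definition phi32_term (R : realType) (a1 a2 a3 b1 b2 q z : R) (k : nat) : R :=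
  qpoch a1 q k * qpoch a2 q k * qpoch a3 q k / (qpoch b1 q k * qpoch b2 q k)
  * (z ^+ k / qpoch q q k).

Definition phi32 (R : realType) (a1 a2 a3 b1 b2 q z : R) : R :=
  limn (series (phi32_term a1 a2 a3 b1 b2 q z)).

Definition mu (R : realType) (q s x : R) : R := q `^ (- x) + s * q `^ (x + 1).

(* D_n^{(s)}(y|q) as a polynomial in y; lemma dual_qultra_phi32 below shows
   that it has the defining 3phi2 representation. *)
Definition dual_qultra (R : realType) (q s : R) (n : nat) : {poly R} :=
  \sum_(k < n.+1)
    (qpoch (q ^- n) q k / (qpoch (s * q ^+ 2) (q ^+ 2) k * qpoch q q k)
     * (- q ^+ n.+1) ^+ k)
    *: \prod_(j < k) ((1 + s * q ^+ (2 * j + 1))%:P - q ^+ j *: 'X).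

(* The sum of f over all integers is l: the partial sums over -M <= m < N tend
   to l as M and N go to infinity independently (Negz i is - (i + 1)). *)
Definition is_bilateral_sum (R : realType) (f : int -> R) (l : R) : Prop :=
  (fun p : nat * nat =>
     \sum_(i < p.1) f (Negz i) + \sum_(i < p.2) f (Posz i))
    @ (\oo, \oo) --> l.

Lemma qpoch_qVn_eq0 (R : realType) (q : R) (n k : nat) :
  q != 0 -> (n < k)%N -> qpoch (q ^- n) q k = 0.
Proof.
move=> q0 nk; apply/eqP; rewrite prodf_seq_eq0; apply/hasP.
exists (Ordinal nk); first by rewrite mem_index_enum.
by rewrite /= mulVf ?subrr // expf_neq0.
Qed.

Lemma dual_qultra_phi32 (R : realType) (q s : R) (n : nat) (x : R) :
  0 < q -> q < 1 -> 0 < s ->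
  (dual_qultra q s n).[mu q s x] =
  phi32 (q `^ (- x)) (s * q `^ (x + 1)) (q ^- n)
        (Num.sqrt s * q) (- (Num.sqrt s * q)) q (- q ^+ n.+1).
Proof.
move=> q0 q1 s0; rewrite /phi32.
set t := phi32_term _ _ _ _ _ _ _.
have t0 k : (n < k)%N -> t k = 0.
  by move=> nk; rewrite /t /phi32_term qpoch_qVn_eq0 ?gt_eqF // mulr0 !mul0r.
have -> : limn (series t) = series t n.+1.
  apply: lim_near_cst => //; exists n.+1 => // m /= nm.
  rewrite -(subnKC nm) /series /=.
  rewrite (big_cat_nat _ (n := n.+1)) ?leq_addr //= [X in _ + X]big_nat_cond.
  by rewrite [X in _ + X]big1 ?addr0 // => i /andP[/andP[+ _] _]; apply: t0.
rewrite /series /= big_mkord /dual_qultra horner_sum.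
apply: eq_bigr => k _; rewrite hornerZ horner_prod /t /phi32_term.
have -> : qpoch (Num.sqrt s * q) q k * qpoch (- (Num.sqrt s * q)) q k =
          qpoch (s * q ^+ 2) (q ^+ 2) k.
  rewrite /qpoch -big_split /=; apply: eq_bigr => j _.
  rewrite -{3}(sqr_sqrtr (ltW s0)) -exprM mulnC exprM; ring.
have -> : \prod_(j < k)
     ((1 + s * q ^+ (2 * j + 1))%:P - q ^+ j *: 'X).[mu q s x] =
   qpoch (q `^ (- x)) q k * qpoch (s * q `^ (x + 1)) q k.
  rewrite /qpoch -big_split /=; apply: eq_bigr => j _.
  rewrite !hornerE /mu.
  have e : q `^ (- x) * q `^ (x + 1) = q.
    have := @powRD _ q (- x) (x + 1); rewrite addKr powRr1 ?ltW // => <- //.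
    by rewrite gt_eqF // implybT.
  have -> : q ^+ (2 * j + 1) = q ^+ j ^+ 2 * (q `^ (- x) * q `^ (x + 1)).
    by rewrite e addn1 exprSr mulnC exprM.
  ring.
by rewrite invfM; ring.
Qed.

(* Main.v *)
(* Let L(p) be the weighted bilateral sum of p(y_m). For the basis
   phi_k(u + 1/u) = (u; q)_k (1/u; q)_k the summand of
   L(phi_(k+1)) + (1 - q^(2k+1)) / q * L(phi_k) has an explicit (Gosper)
   antidifference vanishing at both ends, so L(phi_k) = (-1/q)^k (q; q^2)_k L(1).
   The two halves of the weight interlace to the theta series
   sum_n a^(2n) q^(n(n-1)/2), so L(1) is given by the Jacobi triple product.
   Summing over k gives L(D_n) = 0 for n > 0, and the three-term recurrence
   y D_n = (1 - q^(-2n-1)) D_(n+1) + (1 + 1/q) q^(-2n) D_n + (1 - q^(-2n)) D_(n-1)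
   propagates this to L(D_n D_m) by induction on m. *)
Require Import Defs.
From mathcomp Require Import all_boot all_order all_algebra.
From mathcomp Require Import all_classical all_reals all_analysis.
From mathcomp Require Import ring lra zify.
Set Implicit Arguments.
Unset Strict Implicit.
Unset Printing Implicit Defensive.
Import Order.TTheory GRing.Theory Num.Theory.
Import numFieldNormedType.Exports.
Local Open Scope classical_set_scope.
Local Open Scope ring_scope.

(** * Elementary facts on finite q-shifted factorials *)

Lemma qpochS (R : realType) (x q : R) n :
  qpoch x q n.+1 = qpoch x q n * (1 - x * q ^+ n).
Proof. by rewrite /qpoch big_ord_recr. Qed.

Lemma qpoch0 (R : realType) (x q : R) : qpoch x q 0 = 1.
Proof. by rewrite /qpoch big_ord0. Qed.

(** A subtraction-free form in which [lia] and [nia] can settle identities between quadratic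
    exponents. *)
Lemma double_bin2 m : (2 * 'C(m, 2) + m = m * m)%N.
Proof. by elim: m => [//|m IHm]; rewrite binS bin1; lia. Qed.

Lemma subr1X_neq0 (R : realType) (q : R) m : 0 < q -> q < 1 ->
  1 - q ^+ m.+1 != 0.
Proof.
by move=> q0 q1; rewrite subr_eq0 eq_sym lt_eqF // exprn_ilt1 // ltW.
Qed.

Lemma qpoch_neq0 (R : realType) (q : R) n : 0 < q -> q < 1 -> qpoch q q n != 0.
Proof.
by move=> q0 q1; apply/prodf_neq0 => i _; rewrite -exprS subr1X_neq0.
Qed.

Lemma qpoch_sqr_neq0 (R : realType) (q : R) n : 0 < q -> q < 1 ->
  qpoch q (q ^+ 2) n != 0.
Proof.
by move=> q0 q1; apply/prodf_neq0 => i _; rewrite -exprM -exprS subr1X_neq0.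
Qed.

(** * Bounds and convergence of the infinite products *)

Lemma qpochN_ge1 (R : realType) (x q : R) n :
  0 <= x -> 0 <= q -> 1 <= qpoch (- x) q n.
Proof.
move=> x0 q0; elim: n => [|n IH]; first by rewrite qpoch0.
rewrite qpochS mulNr opprK; have := mulr_ge0 x0 (exprn_ge0 n q0); nra.
Qed.

Lemma qpoch_gt0 (R : realType) (q : R) n : 0 < q -> q < 1 -> 0 < qpoch q q n.
Proof.
move=> q0 q1; apply: prodr_gt0 => i _; rewrite -exprS subr_gt0.
by rewrite exprn_ilt1 // ltW.
Qed.

Lemma sum_geom_le (R : realType) (q : R) n : 0 < q -> q < 1 ->
  \sum_(j < n) q ^+ j <= (1 - q)^-1.
Proof.
move=> q0 q1; rewrite -[leRHS]mul1r ler_pdivlMr ?subr_gt0 //.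
have := subrX1 q n; have := exprn_ge0 n (ltW q0); nra.
Qed.

Lemma qpochN_le_expR (R : realType) (x q : R) n : 0 <= x -> 0 < q -> q < 1 ->
  qpoch (- x) q n <= expR (x / (1 - q)).
Proof.
move=> x0 q0 q1; apply: (@le_trans _ _ (expR (\sum_(j < n) x * q ^+ j))).
  rewrite expR_sum; apply: ler_prod => i _.
  have := mulr_ge0 x0 (exprn_ge0 i (ltW q0)) => h.
  by rewrite mulNr opprK expR_ge1Dx ?addr_ge0.
by rewrite ler_expR -mulr_sumr ler_wpM2l // sum_geom_le.
Qed.

Lemma cvg_qpochN (R : realType) (x q : R) : 0 <= x -> 0 < q -> q < 1 ->
  qpoch (- x) q @ \oo --> qpoch_inf (- x) q.
Proof.
move=> x0 q0 q1; apply: nondecreasing_is_cvgn; last first.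
  by exists (expR (x / (1 - q))) => _ [n _ <-]; exact: qpochN_le_expR.
apply/nondecreasing_seqP => n; rewrite qpochS ler_peMr //.
  by apply: le_trans ler01 _; apply: qpochN_ge1 => //; apply: ltW.
by rewrite mulNr opprK lerDl mulr_ge0 // exprn_ge0 // ltW.
Qed.

(* 1 / (1 - q^(j+1)) <= 1 + q^(j+1) / (1 - q), so that the partial products of
   (q; q) are bounded below by the inverse of a convergent product. *)
Lemma qpoch_ge (R : realType) (q : R) n : 0 < q -> q < 1 ->
  expR (- (q / (1 - q) / (1 - q))) <= qpoch q q n.
Proof.
move=> q0 q1; set x := q / (1 - q).
have x0 : 0 <= x by apply: divr_ge0; rewrite ?subr_ge0 ltW.
have h : 1 <= qpoch q q n * qpoch (- x) q n.
  elim: n => [|n IH]; first by rewrite !qpoch0 mulr1.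
  rewrite !qpochS mulrACA; apply: mulr_ege1 => //.
  have p0 := exprn_ge0 n (ltW q0).
  have p1 : q ^+ n <= 1 by rewrite exprn_ile1 // ltW.
  have xE : x * (1 - q) = q by rewrite /x divfK // gt_eqF // subr_gt0.
  have : 0 <= q ^+ n * (x * q * (1 - q ^+ n)).
    by apply/mulr_ge0/mulr_ge0; rewrite ?subr_ge0 //; apply/mulr_ge0/ltW.
  have -> : (1 - q * q ^+ n) * (1 - - x * q ^+ n) =
      1 + q ^+ n * (x * q * (1 - q ^+ n)) + q ^+ n * (x * (1 - q) - q) by ring.
  by rewrite xE subrr mulr0 addr0 lerDl.
rewrite expRN -[leLHS]mul1r ler_pdivrMr ?expR_gt0 //.
apply: le_trans h _; rewrite ler_wpM2l ?(ltW (qpoch_gt0 _ q0 q1)) //.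
exact: qpochN_le_expR.
Qed.

Lemma cvg_qpoch (R : realType) (q : R) : 0 < q -> q < 1 ->
  qpoch q q @ \oo --> qpoch_inf q q.
Proof.
move=> q0 q1; apply: nonincreasing_is_cvgn; last first.
  by exists 0 => _ [n _ <-]; apply/ltW/qpoch_gt0.
apply/nonincreasing_seqP => n; rewrite qpochS ler_piMr ?(ltW (qpoch_gt0 _ q0 q1)) //.
by rewrite lerBlDr lerDl -exprS exprn_ge0 // ltW.
Qed.

Lemma qpoch_inf_neq0 (R : realType) (q : R) : 0 < q -> q < 1 ->
  qpoch_inf q q != 0.
Proof.
move=> q0 q1; rewrite gt_eqF //.
apply: (@lt_le_trans _ _ (expR (- (q / (1 - q) / (1 - q))))) => [|].
  exact: expR_gt0.
apply: limr_ge; first exact: cvg_qpoch.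
by near=> n; apply: qpoch_ge.
Unshelve. all: by end_near. Qed.

(** * Tannery's theorem and series of Gaussian type *)

(** Weights in [0, 1] keep every sum below l. From below, truncation at a fixed M with tail less
    than eps / 2 leaves a finite sum, where termwise limits suffice. *)
Lemma tannery_bounded (R : realType) (t : R^nat) (e : nat -> R^nat)
    (b : nat -> nat) (l : R) :
  (forall n, n <= b n)%N ->
  (forall i, 0 <= t i) -> series t @ \oo --> l ->
  (forall n i, 0 <= e n i <= 1) ->
  (forall i, e^~ i @ \oo --> (1 : R)) ->
  (fun n => \sum_(i < b n) e n i * t i) @ \oo --> l.
Proof.
move=> hb t0 tl e01 e1; apply/cvgrPdist_lt => eps eps0.
have eps2 : 0 < eps / 2 by rewrite divr_gt0.
have tle n : series t n <= l.
  rewrite -(cvg_lim _ tl) //; apply: nondecreasing_cvgn_le; last exact: cvgP tl.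
  by apply/nondecreasing_seqP => m; rewrite /series /= big_nat_recr //= lerDl.
have [M hM] : exists M, l - eps / 2 < series t M.
  move/cvgrPdist_lt : tl => /(_ _ eps2) [M _ hM]; exists M.
  by have /= := hM M (leqnn M); rewrite ltr_norml; lra.
have c1 : (fun n => \sum_(i < M) e n i * t i) @ \oo --> series t M.
  rewrite /series /= big_mkord.
  elim: M {hM} => [|M IH].
    by under eq_fun do rewrite big_ord0; rewrite big_ord0; apply: cvg_cst.
  under eq_fun do rewrite big_ord_recr; rewrite big_ord_recr /=.
  by apply: cvgD => //; rewrite -[X in _ --> X]mul1r; apply: cvgMr_tmp.
move/cvgrPdist_lt : c1 => /(_ _ eps2) c1.
near=> n.
have nM : (M <= b n)%N by apply: leq_trans (hb n); near: n; exists M.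
have : `|series t M - \sum_(i < M) e n i * t i| < eps / 2 by near: n.
have up : \sum_(i < b n) e n i * t i <= l.
  apply: le_trans (tle (b n)); rewrite /series /= big_mkord; apply: ler_sum => i _.
  by rewrite ler_piMl //; have /andP[] := e01 n i.
have lo : \sum_(i < M) e n i * t i <= \sum_(i < b n) e n i * t i.
  rewrite -!(big_mkord xpredT (fun i => e n i * t i)).
  rewrite (big_cat_nat _ nM) //= lerDl sumr_ge0 // => i _.
  by rewrite mulr_ge0 //; have /andP[] := e01 n i.
rewrite !ltr_norml => /andP[h1 h2]; apply/andP; split; lra.
Unshelve. all: by end_near. Qed.

(** The ratio of consecutive terms is b q^i, at most 1/2 from some N on. The constant C is the sum
    of u_i 2^i over i <= N, so it dominates each of these values. *)
Lemma gauss_le_geom (R : realType) (b q : R) : 0 < b -> 0 < q -> q < 1 ->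
  exists2 C : R, 0 <= C &
    forall i, b ^+ i * q ^+ 'C(i, 2) <= geometric C 2^-1 i.
Proof.
move=> b0 q0 q1.
have [N hN] : exists N, b * q ^+ N <= 2^-1.
  have /cvgrPdist_lt/(_ (2^-1)) : geometric b q @ \oo --> (0 : R).
    by apply: cvg_geometric; rewrite gtr0_norm.
  case; first by rewrite invr_gt0.
  move=> N _ /(_ N (leqnn N)) /=; rewrite sub0r normrN gtr0_norm; last first.
    by rewrite mulr_gt0 // exprn_gt0.
  by move=> /ltW; exists N.
pose u i := b ^+ i * q ^+ 'C(i, 2).
have u0 i : 0 < u i by rewrite /u mulr_gt0 // exprn_gt0.
have uS i : u i.+1 = (b * q ^+ i) * u i.
  by rewrite /u binS bin1 exprD exprS; ring.
pose C := \sum_(i < N.+1) u i * 2 ^+ i.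
have g0 i : 0 < (2 : R) ^+ i by rewrite exprn_gt0.
exists C => [|i]; first by apply: sumr_ge0 => i _; rewrite mulr_ge0 // ltW.
rewrite /= -/(u i) exprVn ler_pdivlMr //.
have small j : (j <= N)%N -> u j * 2 ^+ j <= C.
  move=> jN; rewrite /C (bigD1 (Ordinal (jN : (j < N.+1)%N))) //= lerDl.
  by apply: sumr_ge0 => k _; rewrite mulr_ge0 // ltW.
have [/small//|Ni] := leqP i N; rewrite -(subnKC (ltnW Ni)).
elim: (i - N)%N => [|j IH]; first by rewrite addn0 small.
rewrite addnS uS exprS; apply: le_trans IH.
have le2 : b * q ^+ (N + j) <= 2^-1.
  apply: le_trans hN; rewrite ler_pM2l // exprD ler_piMr //.
    by rewrite exprn_ge0 // ltW.
  by rewrite exprn_ile1 // ltW.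
have := mulr_gt0 (u0 (N + j)%N) (g0 (N + j)%N); nra.
Qed.

Lemma is_cvg_series_gauss (R : realType) (b q : R) : 0 < b -> 0 < q -> q < 1 ->
  cvgn (series (fun i => b ^+ i * q ^+ 'C(i, 2))).
Proof.
move=> b0 q0 q1; have [C C0 hC] := gauss_le_geom b0 q0 q1.
apply: series_le_cvg hC _ => [n|n|].
- by rewrite mulr_ge0 // exprn_ge0 // ltW.
- by rewrite /= mulr_ge0 // exprn_ge0.
- by apply: is_cvg_geometric_series; rewrite ger0_norm; lra.
Qed.

Lemma cvg_gauss0 (R : realType) (b q : R) : 0 < b -> 0 < q -> q < 1 ->
  (fun i => b ^+ i * q ^+ 'C(i, 2)) @ \oo --> (0 : R).
Proof. by move=> b0 q0 q1; apply/cvg_series_cvg_0/is_cvg_series_gauss. Qed.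

(** * The q-binomial theorem and the Jacobi triple product *)

(** Gaussian binomial coefficient. For j > n the subtraction n - j truncates to 0, hence the guard;
    the value 0 there makes the q-Pascal rule hold at j = n. *)
Definition qbin (R : realType) (q : R) (n j : nat) : R :=
  if (j <= n)%N then qpoch q q n / (qpoch q q j * qpoch q q (n - j)) else 0.

Lemma qbinSS (R : realType) (q : R) n j : 0 < q -> q < 1 ->
  qbin q n.+1 j.+1 = qbin q n j.+1 + q ^+ (n - j) * qbin q n j.
Proof.
move=> q0 q1; have nz m := qpoch_neq0 m q0 q1.
have nz1 m : 1 - q * q ^+ m != 0 by rewrite -exprS subr1X_neq0.
rewrite /qbin ltnS; have [jn|nj] := leqP j n; last first.
  by rewrite ltnNge (ltnW nj) /= mulr0 addr0.
have [->|njn] := eqVneq j n.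
  by rewrite ltnn !subnn !qpoch0 expr0; field; rewrite !nz.
have {jn} jn : (j < n)%N by rewrite ltn_neqAle njn.
rewrite jn subSS -(subnSK jn); set d := (n - j.+1)%N.
have -> : n = (j + d.+1)%N by rewrite /d; lia.
rewrite !qpochS !exprD !exprS; field.
by rewrite !nz !nz1.
Qed.

Lemma qbinomial (R : realType) (q x : R) n : 0 < q -> q < 1 ->
  qpoch (- x) q n = \sum_(j < n.+1) qbin q n j * (q ^+ 'C(j, 2) * x ^+ j).
Proof.
move=> q0 q1; have nz m := qpoch_neq0 m q0 q1.
have b0 m : qbin q m 0 = 1.
  by rewrite /qbin leq0n subn0 qpoch0 mul1r divff.
elim: n => [|n IH].
  by rewrite big_ord_recr big_ord0 /= qpoch0 b0 bin0n !expr0; ring.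
rewrite qpochS [RHS]big_ord_recl b0 /=.
under [X in _ = _ + X]eq_bigr => j _.
  rewrite /bump add1n /= qbinSS // mulrDl.
  over.
rewrite big_split /= addrA.
(* Together with the term j = 0, the first half of the Pascal split is the expansion at n again,
   since [qbin q n n.+1] is 0. *)
rewrite [X in _ = X + _](_ : _ = qpoch (- x) q n); last first.
  rewrite IH [in RHS]big_ord_recl b0 /= [in LHS]big_ord_recr /=.
  by rewrite {2}/qbin ltnn mul0r addr0.
rewrite mulNr opprK mulrDr mulr1; congr (_ + _); rewrite IH mulr_suml.
apply: eq_bigr => j _; rewrite binS bin1 exprD exprS.
have -> : q ^+ n = q ^+ (n - j) * q ^+ j.
  by rewrite -exprD subnK // -ltnS.
ring.
Qed.

(** The 2N factors are 1 + x q^i for -N <= i < N. Those with negative exponent are turned around by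
    1 + x / q^i = (x / q^i) (1 + q^i / x), and the extracted monomials cancel against the second
    factor on the left. *)
Lemma prod_qpochN (R : realType) (q x : R) N : q != 0 -> x != 0 ->
  qpoch (- (x / q ^+ N)) q (2 * N) * (q ^+ 'C(N.+1, 2) / x ^+ N) =
  qpoch (- x) q N * qpoch (- (q / x)) q N.
Proof.
move=> q0 x0; rewrite mul2n -addnn.
have -> : qpoch (- (x / q ^+ N)) q (N + N) =
    qpoch (- (x / q ^+ N)) q N * qpoch (- x) q N.
  rewrite /qpoch big_split_ord /=; congr (_ * _).
  by apply: eq_bigr => i _; rewrite exprD; field; rewrite expf_neq0.
rewrite mulrC mulrA mulrC; congr (_ * _).
rewrite /qpoch [in LHS](reindex_inj rev_ord_inj) /=.
elim: N => [|N IH]; first by rewrite !big_ord0 bin_small // expr0 divr1 mulr1.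
rewrite big_ord_recr [RHS]big_ord_recr /= -IH binS bin1 exprD subnn.
rewrite (eq_bigr (fun i : 'I_N => 1 - - (x / q ^+ N) * q ^+ (N - i.+1))).
  rewrite !exprS; field; by rewrite expf_neq0 // expf_neq0 // x0 q0.
move=> i _; rewrite subSS -(subnSK (ltn_ord i)).
by rewrite !exprS; field; rewrite expf_neq0.
Qed.

(** The factor (q; q)_N normalises these weights: they lie in [0, 1] and tend to 1 for fixed i, as
    Tannery's theorem requires. *)
Definition jtp_coef (R : realType) (q : R) (N i : nat) : R :=
  qpoch q q N * qbin q (2 * N) (N + i).

(* The sum over 0 <= j <= 2N of the q-binomial theorem is centred at j = N. *)
Lemma finite_jtp (R : realType) (q x : R) N : 0 < q -> q < 1 -> 0 < x ->
  qpoch q q N * (qpoch (- x) q N * qpoch (- (q / x)) q N) =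
  \sum_(i < N.+1) jtp_coef q N i * (x ^+ i * q ^+ 'C(i, 2)) +
  \sum_(i < N) jtp_coef q N i.+1 * (q / x * ((q / x * q) ^+ i * q ^+ 'C(i, 2))).
Proof.
move=> q0 q1 x0.
have qn := lt0r_neq0 q0; have xn := lt0r_neq0 x0.
rewrite -prod_qpochN // qbinomial // mulr_suml mulr_sumr.
have -> : (2 * N).+1 = (N + N.+1)%N by rewrite mul2n -addnn addnS.
rewrite big_split_ord /= addrC; congr (_ + _).
  apply: eq_bigr => i _; rewrite /jtp_coef -!mulrA; congr (_ * (_ * _)).
  have -> : q ^+ 'C(N + i, 2) = q ^+ 'C(N, 2) * q ^+ 'C(i, 2) * (q ^+ N) ^+ i.
    rewrite -exprM -!exprD; congr (_ ^+ _).
    elim: (i : nat) => [|k IHk]; first by rewrite addn0 bin0n muln0; lia.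
    by rewrite addnS !binS !bin1 mulnS; lia.
  have -> : q ^+ 'C(N.+1, 2) = q ^+ N * q ^+ 'C(N, 2).
    by rewrite -exprD binS bin1 addnC.
  have e : q ^+ N * q ^+ 'C(N, 2) * q ^+ 'C(N, 2) = (q ^+ N) ^+ N.
    rewrite -!exprD -exprM; congr (_ ^+ _).
    by elim: (N) => [//|k IHk]; rewrite ?binS ?bin1; lia.
  rewrite expr_div_n !exprD -e; field.
  by rewrite !expf_neq0.
(* Lower half: the reversal j = N - (i + 1) and the symmetry of the q-binomial give the negative
   powers of x. *)
rewrite (reindex_inj rev_ord_inj) /=; apply: eq_bigr => i _.
have iN := ltn_ord i.
rewrite /jtp_coef -!mulrA; congr (_ * _).
have -> : qbin q (2 * N) (N - i.+1) = qbin q (2 * N) (N + i.+1).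
  rewrite /qbin; have -> : (N - i.+1 <= 2 * N)%N by lia.
  have -> : (N + i.+1 <= 2 * N)%N by lia.
  have -> : (2 * N - (N - i.+1) = N + i.+1)%N by lia.
  have -> : (2 * N - (N + i.+1) = N - i.+1)%N by lia.
  by rewrite [X in _ / X]mulrC.
congr (_ * _).
move: (nat_of_ord i) iN => {}i iN.
have [k ->] : exists k, N = (k + i.+1)%N by exists (N - i.+1)%N; rewrite subnK.
rewrite addnK.
have -> : (q * (x^-1 * q)) ^+ i = q ^+ (2 * i) / x ^+ i.
  by rewrite mulrCA -expr2 exprMn -exprM exprVn mulrC.
have e : q ^+ 'C((k + i.+1).+1, 2) * q ^+ 'C(k, 2) =
         q ^+ (2 * i).+1 * q ^+ 'C(i, 2) * q ^+ (k + i.+1) ^+ k.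
  rewrite -exprM -!exprD; congr (_ ^+ _).
  have := double_bin2 (k + i.+1).+1; have := double_bin2 k.
  by have := double_bin2 i; nia.
have -> : x ^+ (k + i.+1) = x ^+ k * (x * x ^+ i) by rewrite exprD exprS.
rewrite expr_div_n.
transitivity ((q ^+ 'C((k + i.+1).+1, 2) * q ^+ 'C(k, 2)) / q ^+ (k + i.+1) ^+ k
   / x / x ^+ i); first by field; rewrite !expf_neq0 // xn.
by rewrite e exprS; field; rewrite !expf_neq0 // xn.
Qed.

Lemma qpoch_le (R : realType) (q : R) m n : 0 < q -> q < 1 -> (m <= n)%N ->
  qpoch q q n <= qpoch q q m.
Proof.
move=> q0 q1 /subnKC <-; elim: (n - m)%N => [|k IH]; first by rewrite addn0.
rewrite addnS qpochS; apply: le_trans IH.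
rewrite ler_piMr ?(ltW (qpoch_gt0 _ q0 q1)) //.
by rewrite lerBlDr lerDl -exprS exprn_ge0 // ltW.
Qed.

Lemma jtp_coefE (R : realType) (q : R) N i : (i <= N)%N -> jtp_coef q N i =
  qpoch q q N * (qpoch q q (2 * N) / (qpoch q q (N + i) * qpoch q q (N - i))).
Proof.
move=> iN; rewrite /jtp_coef /qbin.
have -> : (N + i <= 2 * N)%N by lia.
by have -> : (2 * N - (N + i) = N - i)%N by lia.
Qed.

Lemma jtp_coef01 (R : realType) (q : R) N i : 0 < q -> q < 1 ->
  0 <= jtp_coef q N i <= 1.
Proof.
move=> q0 q1; have pos m := qpoch_gt0 m q0 q1.
have [iN|Ni] := leqP i N; last first.
  rewrite /jtp_coef /qbin leqNgt; have -> : (2 * N < N + i)%N by lia.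
  by rewrite mulr0 lexx ler01.
rewrite jtp_coefE //; apply/andP; split.
  by apply/mulr_ge0/divr_ge0/ltW/mulr_gt0; rewrite ?ltW.
rewrite mulrA ler_pdivrMr ?mulr_gt0 // mul1r mulrC.
by apply: ler_pM; rewrite ?(ltW (pos _)) // qpoch_le //; lia.
Qed.

Lemma cvg_jtp_coef (R : realType) (q : R) i : 0 < q -> q < 1 ->
  (jtp_coef q)^~ i @ \oo --> (1 : R).
Proof.
move=> q0 q1; have c0 := qpoch_inf_neq0 q0 q1; have c := cvg_qpoch q0 q1.
have lim : (fun N => qpoch q q N *
    (qpoch q q (2 * N) / (qpoch q q (N + i) * qpoch q q (N - i)))) @ \oo -->
    qpoch_inf q q * (qpoch_inf q q / (qpoch_inf q q * qpoch_inf q q)).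
  apply: cvgM => //; apply: cvgM; first by apply: cvg_comp c; apply: cvg_mulnl.
  apply: cvgV; first by rewrite mulf_neq0.
  by apply: cvgM; apply: cvg_comp c; [apply: cvg_addnr|apply: cvg_subnr].
rewrite invfM mulVKf // divff // in lim.
apply: cvg_trans lim; apply: near_eq_cvg.
by near=> N; rewrite jtp_coefE //; near: N; exists i.
Unshelve. all: by end_near. Qed.

(** The limit of [finite_jtp] as N grows. The term i of the second series has theta index -(i +
    1). *)
Lemma jacobi_triple_product (R : realType) (q x : R) (l1 l2 : R) :
  0 < q -> q < 1 -> 0 < x ->
  series (fun i => x ^+ i * q ^+ 'C(i, 2)) @ \oo --> l1 ->
  series (fun i => q / x * ((q / x * q) ^+ i * q ^+ 'C(i, 2))) @ \oo --> l2 ->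
  l1 + l2 = qpoch_inf (- x) q * qpoch_inf (- (q / x)) q * qpoch_inf q q.
Proof.
move=> q0 q1 x0 c1 c2; have y0 : 0 < q / x by rewrite divr_gt0.
have d1 := tannery_bounded (fun n => leqnSn n) (fun i => _) c1
  (fun n i => jtp_coef01 n i q0 q1) (fun i => cvg_jtp_coef i q0 q1).
have d2 := tannery_bounded (e := fun n i => jtp_coef q n i.+1) leqnn (fun i => _) c2
  (fun n i => jtp_coef01 n i.+1 q0 q1) (fun i => cvg_jtp_coef i.+1 q0 q1).
pose F N := qpoch q q N * (qpoch (- x) q N * qpoch (- (q / x)) q N).
have lim1 : F @ \oo --> l1 + l2.
  rewrite /F; under eq_fun do rewrite finite_jtp //.
  apply: cvgD; [apply: d1 => i|apply: d2 => i].
    by rewrite mulr_ge0 // exprn_ge0 // ltW.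
  apply: mulr_ge0 (ltW y0) _.
  by apply: mulr_ge0; apply: exprn_ge0; rewrite ltW // mulr_gt0.
have lim2 : F @ \oo --> qpoch_inf (- x) q * qpoch_inf (- (q / x)) q * qpoch_inf q q.
  rewrite mulrC; apply: cvgM; first exact: cvg_qpoch.
  by apply: cvgM; apply: cvg_qpochN => //; apply: ltW.
by rewrite -(cvg_lim _ lim1) // (cvg_lim _ lim2).
Qed.

(** * Bilateral sums: linearity and telescoping *)

Lemma is_bilateral_sum_series (R : realType) (f : int -> R) (l1 l2 : R) :
  (fun n => \sum_(i < n) f (Negz i)) @ \oo --> l1 ->
  (fun n => \sum_(i < n) f (Posz i)) @ \oo --> l2 ->
  is_bilateral_sum f (l1 + l2).
Proof.
move=> c1 c2; rewrite /is_bilateral_sum.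
apply: cvgD.
  by apply: (cvg_comp (fun p : nat * nat => p.1)
    (fun n => \sum_(i < n) f (Negz i))) c1; apply: cvg_fst.
by apply: (cvg_comp (fun p : nat * nat => p.2)
  (fun n => \sum_(i < n) f (Posz i))) c2; apply: cvg_snd.
Qed.

Lemma is_bilateral_sum_lin (R : realType) (f g : int -> R) (c l l' : R) :
  is_bilateral_sum f l -> is_bilateral_sum g l' ->
  is_bilateral_sum (fun m => c * f m + g m) (c * l + l').
Proof.
rewrite /is_bilateral_sum => hf hg.
under eq_fun do rewrite !big_split /= -!mulr_sumr addrACA -mulrDr.
by apply: cvgD => //; apply: cvgMl_tmp.
Qed.

Definition vanishing (R : realType) (f : int -> R) : Prop :=
  ((fun n : nat => f (Posz n)) @ \oo --> (0 : R)) /\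
  ((fun n : nat => f (Negz n)) @ \oo --> (0 : R)).

(** The half sums are G(0) - G(-M) and G(N) - G(0), so the boundary value G(0) cancels. *)
Lemma is_bilateral_sum_telescope (R : realType) (f G : int -> R) :
  vanishing G -> (forall m, f m = G (m + 1) - G m) -> is_bilateral_sum f 0.
Proof.
move=> [cP cN] fE; rewrite -[0](addrN (G 0)).
apply: is_bilateral_sum_series.
  have e n : \sum_(i < n.+1) f (Negz i) = G 0 - G (Negz n).
    elim: n => [|n IH]; first by rewrite big_ord_recr /= big_ord0 add0r fE.
    rewrite big_ord_recr IH fE /=.
    have -> : Negz n.+1 + 1 = Negz n by rewrite !NegzE; lia.
    by rewrite addrA subrK.
  rewrite -(cvg_shiftS (fun n => \sum_(i < n) f (Negz i))) (funext e).
  have h := cvgB (cvg_cst (G 0)) cN; rewrite subr0 in h; exact: h.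
have e n : \sum_(i < n) f (Posz i) = G (Posz n) - G 0.
  elim: n => [|n IH]; first by rewrite big_ord0 subrr.
  rewrite big_ord_recr IH fE /=.
  have -> : Posz n + 1 = Posz n.+1 by lia.
  by rewrite addrC addrA subrK.
rewrite (funext e).
by have h := cvgB cP (cvg_cst (G 0)); rewrite sub0r in h; exact: h.
Qed.

(** * Expansion of D_n in the basis phi_k and its three-term recurrence *)

(* With c = q^n this is q^(nk) (q^(-n); q)_k. *)
Definition vfac (R : realType) (c q : R) (k : nat) : R :=
  \prod_(j < k) (c - q ^+ j).

(* phi_k (u + 1/u) = (u; q)_k (1/u; q)_k, as s = 1/q. *)
Definition phi (R : realType) (q : R) (k : nat) : {poly R} :=
  \prod_(j < k) ((1 + q^-1 * q ^+ (2 * j + 1))%:P - q ^+ j *: 'X).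

(** The part of the k-th coefficient of D_n that does not depend on n: the factor q^(nk) of
    (-q^(n+1))^k has gone into [vfac], and s q^2 = q. *)
Definition dcoef (R : realType) (q : R) (k : nat) : R :=
  (- q) ^+ k / (qpoch q (q ^+ 2) k * qpoch q q k).

Lemma vfacS (R : realType) (c q : R) k :
  vfac c q k.+1 = vfac c q k * (c - q ^+ k).
Proof. by rewrite /vfac big_ord_recr. Qed.

Lemma vfacX_eq0 (R : realType) (q : R) n k : (n < k)%N -> vfac (q ^+ n) q k = 0.
Proof.
move=> nk; apply/eqP; rewrite prodf_seq_eq0; apply/hasP.
by exists (Ordinal nk); rewrite ?mem_index_enum //= subrr.
Qed.

Lemma phiS (R : realType) (q : R) k : q != 0 ->
  phi q k.+1 = (1 + q ^+ k ^+ 2) *: phi q k - q ^+ k *: ('X * phi q k).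
Proof.
move=> q0; rewrite /phi big_ord_recr /=.
have -> : q^-1 * q ^+ (2 * k + 1) = q ^+ k ^+ 2.
  by rewrite addn1 exprS mulKf // mulnC exprM.
by rewrite mulrBr mulrC mul_polyC -scalerAr ['X * _]mulrC.
Qed.

(** As [vfac] at q^n vanishes for k > n, the range may be lengthened; D_(n-1), D_n and D_(n+1) can
    then share one range of summation. *)
Lemma dual_qultraE (R : realType) (q : R) n N : q != 0 -> (n <= N)%N ->
  dual_qultra q q^-1 n =
  \sum_(k < N.+1) (vfac (q ^+ n) q k * dcoef q k) *: phi q k.
Proof.
move=> q0 nN.
have -> : \sum_(k < N.+1) (vfac (q ^+ n) q k * dcoef q k) *: phi q k =
          \sum_(k < n.+1) (vfac (q ^+ n) q k * dcoef q k) *: phi q k.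
  rewrite -!(big_mkord xpredT (fun k => (vfac (q ^+ n) q k * dcoef q k) *: phi q k)).
  rewrite (big_cat_nat _ (n := n.+1)) //= [X in _ + X]big_nat_cond.
  rewrite [X in _ + X]big1 ?addr0 //.
  by move=> k /andP[/andP[nk _] _]; rewrite vfacX_eq0 // mul0r scale0r.
apply: eq_bigr => k _; congr (_ *: _).
have -> : q^-1 * q ^+ 2 = q by rewrite expr2 mulKf.
rewrite /dcoef mulrA -mulrAC; congr (_ / _).
rewrite exprS -mulNr [- q * _]mulrC exprMn mulrA; congr (_ * _).
elim: (k : nat) => [|j IH]; first by rewrite qpoch0 /vfac big_ord0 expr0 mulr1.
rewrite qpochS vfacS -IH exprSr; field.
by rewrite expf_neq0.
Qed.

(* Both sides are Laurent polynomials in c = q^n, so that the boundary cases k = n,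
   n + 1 of the recurrence need no separate treatment. *)
Lemma vfac_recurrence (R : realType) (c q : R) k : 0 < q -> q < 1 -> c != 0 ->
  (1 + q ^+ k.+1 ^+ 2) / q ^+ k.+1 * (vfac c q k.+1 * dcoef q k.+1)
    - (vfac c q k * dcoef q k) / q ^+ k =
  ((1 - (q * c ^+ 2)^-1) * vfac (q * c) q k.+1
   + (1 + q^-1) / c ^+ 2 * vfac c q k.+1
   + (1 + c) / c ^+ 2 * ((c - 1) * vfac (c / q) q k.+1)) * dcoef q k.+1.
Proof.
move=> q0 q1 c0; have qn := lt0r_neq0 q0.
have nz1 m := subr1X_neq0 m q0 q1.
have v1 : vfac (q * c) q k.+1 = q ^+ k * (q * c - 1) * vfac c q k.
  elim: k => [|j IH]; first by rewrite vfacS /vfac !big_ord0 expr0; ring.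
  by rewrite vfacS IH [in RHS]vfacS !exprS; ring.
(* The factor c - 1 completes the shifted product (c - q) ... (c - q^j) to one that starts at
   exponent 0. *)
have v2 j : (c - 1) * vfac (c / q) q j = (q ^+ j)^-1 * (c - q ^+ j) * vfac c q j.
  elim: j => [|j IH]; first by rewrite /vfac !big_ord0 expr0; field.
  rewrite [in LHS]vfacS mulrA IH [in RHS]vfacS !exprS; field.
  by rewrite qn expf_neq0.
have dS : dcoef q k = dcoef q k.+1 * ((1 - q ^+ (2 * k).+1) * (1 - q ^+ k.+1)) / - q.
  have nz2 m := qpoch_sqr_neq0 m q0 q1.
  have nz3 m := qpoch_neq0 m q0 q1.
  rewrite /dcoef !qpochS -exprM -!exprS [(- q) ^+ _.+1]exprS; field.
  by rewrite !nz1 nz2 nz3 qn.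
rewrite v1 v2 dS vfacS !exprS mulnC exprM; field.
by rewrite qn c0 expf_neq0.
Qed.

Lemma dual_qultra_recurrence (R : realType) (q : R) n : 0 < q -> q < 1 ->
  'X * dual_qultra q q^-1 n =
  (1 - (q * q ^+ n ^+ 2)^-1) *: dual_qultra q q^-1 n.+1
  + ((1 + q^-1) / q ^+ n ^+ 2) *: dual_qultra q q^-1 n
  + (1 - (q ^+ n ^+ 2)^-1) *: dual_qultra q q^-1 n.-1.
Proof.
move=> q0 q1; have qn := lt0r_neq0 q0.
have cn : q ^+ n != 0 by rewrite expf_neq0.
have Xphi k : 'X * phi q k =
    ((1 + q ^+ k ^+ 2) / q ^+ k) *: phi q k - (q ^+ k)^-1 *: phi q k.+1.
  have qk : q ^+ k != 0 by rewrite expf_neq0.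
  rewrite phiS // scalerBr !scalerA mulVf // scale1r.
  by rewrite [_^-1 * _]mulrC opprB addrC subrK.
(* With c = q^n, 1 - c^(-2) = (1 + c) (c - 1) / c^2. For n = 0 both sides vanish, so the truncated
   [n.-1] does no harm. *)
have eB : (1 - (q ^+ n ^+ 2)^-1) *: dual_qultra q q^-1 n.-1 =
    \sum_(k < n.+2) ((1 + q ^+ n) / q ^+ n ^+ 2
      * ((q ^+ n - 1) * vfac (q ^+ n / q) q k) * dcoef q k) *: phi q k.
  case: n cn => [|n] cn.
    rewrite expr0 expr1n invr1 subrr scale0r big1 // => i _.
    by rewrite mul0r mulr0 mul0r scale0r.
  rewrite (dual_qultraE (N := n.+2)) ?leqW // scaler_sumr.
  apply: eq_bigr => k _; rewrite scalerA; congr (_ *: _).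
  have -> : q ^+ n.+1 / q = q ^+ n by rewrite exprSr mulfK.
  by field.
rewrite (dual_qultraE (N := n.+1) qn (leqnSn _)) eB.
rewrite (dual_qultraE (N := n.+1) (n := n.+1)) // mulr_sumr.
under eq_bigr => k _ do rewrite -scalerAr Xphi scalerBr !scalerA.
rewrite sumrB !scaler_sumr -!big_split /=.
(* No phi_(n+2) arises: the coefficient of D_n at k = n + 1 is 0. *)
rewrite [X in _ - X]big_ord_recr /= vfacX_eq0 // !mul0r scale0r addr0.
rewrite big_ord_recl [RHS]big_ord_recl -[LHS]addrA -sumrB; congr (_ + _).
  rewrite !scalerA -!scalerDl; congr (_ *: _).
  by rewrite /vfac /dcoef !big_ord0 !qpoch0 !expr0; field; rewrite ?cn ?qn.
apply: eq_bigr => k _; rewrite !lift0 !scalerA -scalerBl -!scalerDl.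
congr (_ *: _); rewrite [LHS](_ : _ =
  (1 + q ^+ k.+1 ^+ 2) / q ^+ k.+1 * (vfac (q ^+ n) q k.+1 * dcoef q k.+1)
    - (vfac (q ^+ n) q k * dcoef q k) / q ^+ k); last by rewrite mulrC.
by rewrite vfac_recurrence // [q ^+ n.+1]exprS; ring.
Qed.

(** By [e] the new term is (c - 1) / (1 - q^(n+1)) times the previous product, and 1 - q^(n+1) + c -
    1 = c - q^(n+1). At c = q^n with n > 0 the last factor is 0, which is why L(D_n) vanishes. *)
Lemma sum_vfac (R : realType) (c q : R) n : 0 < q -> q < 1 ->
  \sum_(k < n.+1) vfac c q k / qpoch q q k =
  \prod_(j < n) ((c - q ^+ j.+1) / (1 - q ^+ j.+1)).
Proof.
move=> q0 q1.
have nz1 m := subr1X_neq0 m q0 q1.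
have nz3 m := qpoch_neq0 m q0 q1.
have e m : vfac c q m.+1 / qpoch q q m =
    (c - 1) * \prod_(j < m) ((c - q ^+ j.+1) / (1 - q ^+ j.+1)).
  elim: m => [|m IH]; first by rewrite vfacS /vfac qpoch0 !big_ord0 expr0 divr1; ring.
  rewrite vfacS qpochS -exprS big_ord_recr /= mulrA -IH; field.
  by rewrite nz1 nz3.
elim: n => [|n IH]; first by rewrite big_ord1 big_ord0 /vfac qpoch0 big_ord0 divr1.
rewrite big_ord_recr IH [RHS]big_ord_recr /=.
have -> : vfac c q n.+1 / qpoch q q n.+1 =
    vfac c q n.+1 / qpoch q q n / (1 - q ^+ n.+1).
  by rewrite qpochS -exprS invfM mulrA.
by rewrite e; field.
Qed.

(** * Orthogonality from a three-term recurrence *)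

(** [L] is a relation rather than a function, so that convergence is carried along with the value.
    By strong induction on m, the recurrence at m eliminates D_(m+1) and the one at n then rewrites
    y D_n. *)
Lemma orthogonal_of_recurrence (R : fieldType) (L : {poly R} -> R -> Prop)
    (D : nat -> {poly R}) (A B C h : nat -> R) :
  (forall c p v p' v', L p v -> L p' v' -> L (c *: p + p') (c * v + v')) ->
  (forall n, A n != 0) -> C 0 = 0 ->
  (forall n, 'X * D n = A n *: D n.+1 + B n *: D n + C n *: D n.-1) ->
  (forall n, C n.+1 * h n = A n * h n.+1) ->
  D 0 = 1 -> (forall n, L (D n) (h n * (n == 0)%:R)) ->
  forall n m, L (D n * D m) (h n * (n == m)%:R).
Proof.
move=> Llin An C0 rec hrec D0 base n m; elim/ltn_ind: m n => -[|m] IH n.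
  by rewrite D0 mulr1; apply: base.
have {}IH j i : (j <= m)%N -> L (D i * D j) (h i * (i == j)%:R) by move=> ?; apply: IH.
have L0 : L 0 0.
  have := Llin (-1) _ _ _ _ (base 0) (base 0).
  by rewrite scaleN1r mulN1r !addNr.
have eD : D n * D m.+1 =
  (A n / A m) *: (D n.+1 * D m) + ((B n - B m) / A m *: (D n * D m) +
  (C n / A m *: (D n.-1 * D m) + ((- C m / A m) *: (D n * D m.-1) + 0))).
  have e : A m *: D m.+1 = 'X * D m - B m *: D m - C m *: D m.-1.
    by rewrite rec -[RHS]addrA -opprD -[X in X - _]addrA addrK.
  apply: (scalerI (An m)); rewrite addr0 scalerAr e !scalerDr !scalerA.
  rewrite ![A m * _]mulrC !divfK // !mulrBr mulrCA mulrA rec !mulrDl.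
  rewrite -!scalerAl -!scalerAr scalerBl scaleNr; ring.
rewrite eD.
have := Llin (A n / A m) _ _ _ _ (IH m n.+1 (leqnn _))
  (Llin ((B n - B m) / A m) _ _ _ _ (IH m n (leqnn _))
  (Llin (C n / A m) _ _ _ _ (IH m n.-1 (leqnn _))
  (Llin (- C m / A m) _ _ _ _ (IH m.-1 n (leq_pred _)) L0))).
congr (L _ _); rewrite addr0.
have F (a b : nat) : (a <> b -> (a == b) = false)%N by move/eqP/negbTE.
(* Diagonal case: only D_(n-1) D_m contributes, and [hrec] turns its value into h_(m+1). *)
have [->|n1] := eqVneq n m.+1.
  rewrite (F m.+2 m) ?(F m.+1 m) ?(F m.+1 m.-1) ?eqxx; try lia.
  rewrite !mulr0 !mulr1 addr0 !add0r /= mulrAC hrec.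
  by rewrite mulrAC divff // mul1r.
have [->|n2] := eqVneq n m.
  rewrite (F m.+1 m) ?(F m m.+1) ?eqxx; try lia.
  rewrite subrr !mul0r !mulr0 !add0r.
  (* At m = 0 the truncated [m.-1] equals m, and C_0 = 0 removes both terms. *)
  case: m {IH eD n1} => [|m]; first by rewrite C0 oppr0 !mul0r !addr0.
  by rewrite (F m m.+1) ?(F m.+1 m) ?mulr0 ?addr0 //=; lia.
have [e3|n3] := eqVneq n.+1 m.
  rewrite -e3 /= eqxx (F n.-1 n.+1); last lia.
  by rewrite !mulr0 add0r !mulr1 add0r mulrAC -hrec; ring.
rewrite (F n.-1 m) ?(F n m.-1) ?mulr0 ?addr0 //; first by move/eqP: n3; lia.
by move/eqP: n1; move/eqP: n2; move/eqP: n3; lia.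
Qed.

(** * The weight on the lattice and its total mass *)

(* With z = a q^m and u = z^2, the weight of the theorem is
   a^(4m+1) q^(2m^2) (1/z + z) = kap(m) (1 + u), and y_m = u + 1/u. *)
Definition kap (R : realType) (a q : R) (m : int) : R :=
  a ^ (4 * m) * q ^ (2 * m ^+ 2 - m).

Definition uu (R : realType) (a q : R) (m : int) : R := a ^ 2 * q ^ (2 * m).

Lemma kapP (R : realType) (a q : R) (n : nat) :
  kap a q (Posz n) = (a ^+ 2) ^+ (2 * n) * q ^+ 'C(2 * n, 2).
Proof.
have e := double_bin2 (2 * n).
rewrite /kap; have -> : 4 * Posz n = Posz (2 * (2 * n)) by lia.
have -> : 2 * Posz n ^+ 2 - Posz n = Posz 'C(2 * n, 2) by rewrite expr2; nia.
by rewrite -exprM.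
Qed.

Lemma kapN (R : realType) (a q : R) (n : nat) :
  kap a q (Negz n) = (a ^+ 2)^-1 ^+ (2 * n.+1) * q ^+ 'C(2 * n.+1 + 1, 2).
Proof.
have e := double_bin2 (2 * n.+1 + 1).
rewrite /kap; have -> : 4 * Negz n = - Posz (2 * (2 * n.+1)) by lia.
have -> : 2 * Negz n ^+ 2 - Negz n = Posz 'C(2 * n.+1 + 1, 2).
  by rewrite NegzE expr2; nia.
by rewrite exprVn -exprM -invr_expz.
Qed.

Lemma uuP (R : realType) (a q : R) (n : nat) :
  uu a q (Posz n) = a ^+ 2 * (q ^+ 2) ^+ n.
Proof. by rewrite -exprM. Qed.

Lemma uuN (R : realType) (a q : R) (n : nat) :
  uu a q (Negz n) = a ^+ 2 * (q ^+ 2)^-1 ^+ n.+1.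
Proof.
rewrite /uu; have -> : 2 * Negz n = - Posz (2 * n.+1) by lia.
by rewrite exprVn -invr_expz -exprM.
Qed.

Lemma kapS (R : realType) (a q : R) (m : int) : a != 0 -> q != 0 ->
  kap a q (m + 1) = kap a q m * (uu a q m ^+ 2 * q).
Proof.
move=> a0 q0; rewrite /kap /uu.
have -> : (4 * (m + 1) = 4 * m + 4)%Z by ring.
have -> : 2 * (m + 1) ^+ 2 - (m + 1) = (2 * m ^+ 2 - m) + 2 * m + 2 * m + 1 by ring.
rewrite !expfzDr // -[q ^ 1%R]/q.
ring.
Qed.

Lemma uuS (R : realType) (a q : R) (m : int) : q != 0 ->
  uu a q (m + 1) = uu a q m * q ^+ 2.
Proof.
move=> q0; rewrite /uu mulrDr (expfzDr (2 * m) _ q0) mulrA mulr1.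
by [].
Qed.

Lemma uu_neq0 (R : realType) (a q : R) (m : int) : a != 0 -> q != 0 ->
  uu a q m != 0.
Proof. by move=> a0 q0; rewrite /uu mulf_neq0 // expfz_neq0. Qed.

(** On each half-line the value is a constant times b^n (q^4)^(n(n-1)/2), which tends to 0 for every
    b > 0. *)
Lemma vanishing_kap_uu (R : realType) (a q : R) (r : int) :
  0 < a -> 0 < q -> q < 1 -> vanishing (fun m => kap a q m * uu a q m ^ r).
Proof.
move=> a0 q0 q1; have p0 : 0 < q ^+ 4 by rewrite exprn_gt0.
have p1 : q ^+ 4 < 1 by rewrite exprn_ilt1 // ltW.
have pos (b : R) (n : int) : 0 < b -> 0 < b ^ n by exact: exprz_gt0.
have powX (b : R) (n : nat) : (b ^+ n) ^ r = (b ^ r) ^+ n.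
  by rewrite -[b ^+ n]/(b ^ n) -[RHS]/((b ^ r) ^ n) !exprz_exp mulrC.
have step (b c : R) (f : nat -> R) : 0 < b ->
    (forall n, f n = c * (b ^+ n * (q ^+ 4) ^+ 'C(n, 2))) ->
    f @ \oo --> (0 : R).
  move=> b0 fE; rewrite (_ : f = fun n => c * (b ^+ n * (q ^+ 4) ^+ 'C(n, 2))).
    by rewrite -[0](mulr0 c); apply: cvgMl_tmp; apply: cvg_gauss0.
  exact/funext.
split.
  apply: (step ((a ^+ 2) ^+ 2 * q * (q ^+ 2) ^ r) ((a ^+ 2) ^ r)).
    by rewrite !mulr_gt0 // ?pos ?exprn_gt0.
  move=> n; rewrite kapP uuP expfzMl (powX (q ^+ 2)).
  have -> : 'C(2 * n, 2) = (n + 4 * 'C(n, 2))%N.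
    by have := double_bin2 (2 * n); have := double_bin2 n; nia.
  by rewrite exprD !exprM !exprMn; ring.
pose b := (a ^+ 2)^-1; pose c := (q ^+ 2)^-1.
apply: (step (b ^+ 2 * q ^+ 7 * c ^ r) (b ^+ 2 * q ^+ 3 * (a ^+ 2) ^ r * c ^ r)).
  by rewrite !mulr_gt0 // ?pos ?exprn_gt0 ?invr_gt0 ?exprn_gt0.
move=> n; rewrite kapN uuN -/b -/c expfzMl (powX c).
have -> : 'C(2 * n.+1 + 1, 2) = (3 + 7 * n + 4 * 'C(n, 2))%N.
  by have := double_bin2 (2 * n.+1 + 1); have := double_bin2 n; nia.
rewrite !exprD !exprM !exprMn !exprS; ring.
Qed.

Lemma sum_pairs (R : realType) (t : R^nat) n :
  \sum_(i < n) (t (2 * i)%N + t (2 * i).+1) = series t (2 * n)%N.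
Proof.
elim: n => [|n IH]; first by rewrite big_ord0 /series /= big_nil.
rewrite big_ord_recr IH /series /= mulnS addSn add1n.
by rewrite big_nat_recr //= big_nat_recr //= addrA.
Qed.

(** With x = a^2 and B = C(2i, 2), the weight at [Negz i] is matched with terms 2i and 2i + 1 of the
    negative half of the theta series. *)
Lemma jtp_pair_neg (F : fieldType) (q x : F) (i B : nat) : q != 0 -> x != 0 ->
  x^-1 ^+ (2 * i).+2 * q ^+ (3 + 6 * i + B) * (x * (q ^+ 2)^-1 ^+ i.+1) +
  x^-1 ^+ (2 * i).+2 * q ^+ (3 + 6 * i + B) =
  q / x * ((q / x * q) ^+ (2 * i) * q ^+ B) +
  q / x * ((q / x * q) ^+ (2 * i).+1 * q ^+ (2 * i + B)).
Proof.
move=> qn xn.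
have e1 : (q / x * q) ^+ (2 * i) = x^-1 ^+ (2 * i) * (q ^+ i) ^+ 4.
  rewrite mulrAC -expr2 mulrC exprMn -!exprM; congr (_ * q ^+ _); lia.
have -> : q ^+ (3 + 6 * i + B) = q ^+ 3 * (q ^+ i) ^+ 6 * q ^+ B.
  by rewrite -exprM -!exprD [(i * 6)%N]mulnC.
have -> : q ^+ (2 * i + B) = (q ^+ i) ^+ 2 * q ^+ B.
  by rewrite -exprM -exprD [(i * 2)%N]mulnC.
have -> : (q ^+ 2)^-1 ^+ i.+1 = (q ^+ 2)^-1 * (q ^+ i) ^- 2.
  by rewrite [LHS]exprS exprVn -!exprM [(i * 2)%N]mulnC.
rewrite [x^-1 ^+ _.+2]exprS [x^-1 ^+ _.+1]exprS [(q / x * q) ^+ _.+1]exprS e1.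
move: (x^-1 ^+ (2 * i)) => X.
by field; rewrite expf_neq0 // xn qn.
Qed.

(** kap(m) and kap(m) u are the theta terms of indices 2m and 2m + 1, so n weights on a half-line
    make up 2n theta terms. *)
Lemma is_bilateral_sum_weight (R : realType) (a q : R) :
  0 < a -> 0 < q -> q < 1 ->
  is_bilateral_sum (fun m => kap a q m * (1 + uu a q m))
    (qpoch_inf (- a ^+ 2) q * qpoch_inf (- (q / a ^+ 2)) q * qpoch_inf q q).
Proof.
move=> a0 q0 q1; set x := a ^+ 2; have x0 : 0 < x by rewrite exprn_gt0.
have y0 : 0 < q / x * q by rewrite mulr_gt0 // divr_gt0.
have c1 : series (fun i => x ^+ i * q ^+ 'C(i, 2)) @ \oo --> _ :=
  is_cvg_series_gauss x0 q0 q1.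
have c2 : series (fun i => q / x * ((q / x * q) ^+ i * q ^+ 'C(i, 2))) @ \oo -->
    q / x * limn (series (fun i => (q / x * q) ^+ i * q ^+ 'C(i, 2))).
  rewrite /series /=; under eq_fun do rewrite -mulr_sumr.
  by apply: cvgMl_tmp; exact: is_cvg_series_gauss.
rewrite -(jacobi_triple_product q0 q1 x0 c1 c2) addrC.
have xn := lt0r_neq0 x0; have qn := lt0r_neq0 q0.
apply: is_bilateral_sum_series.
  have e n : \sum_(i < n) (kap a q (Negz i) * (1 + uu a q (Negz i))) =
      series (fun i => q / x * ((q / x * q) ^+ i * q ^+ 'C(i, 2))) (2 * n)%N.
    rewrite -sum_pairs; apply: eq_bigr => i _.
    rewrite kapN uuN -/x mulrDr mulr1 addrC.
    have -> : 'C(2 * i.+1 + 1, 2) = (3 + 6 * i + 'C(2 * i, 2))%N.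
      by have := double_bin2 (2 * i.+1 + 1); have := double_bin2 (2 * i); nia.
    have -> : 'C((2 * i).+1, 2) = (2 * i + 'C(2 * i, 2))%N by rewrite binS bin1 addnC.
    have -> : (2 * i.+1 = (2 * i).+2)%N by lia.
    move: 'C(2 * i, 2) => B.
    exact: jtp_pair_neg.
  by rewrite (funext e); apply: cvg_comp c2; apply: cvg_mulnl.
have e n : \sum_(i < n) (kap a q (Posz i) * (1 + uu a q (Posz i))) =
    series (fun i => x ^+ i * q ^+ 'C(i, 2)) (2 * n)%N.
  rewrite -sum_pairs; apply: eq_bigr => i _.
  have -> : q ^+ 'C((2 * i).+1, 2) = (q ^+ 2) ^+ i * q ^+ 'C(2 * i, 2).
    by rewrite -exprM -exprD binS bin1 addnC.
  by rewrite kapP uuP -/x [x ^+ _.+1]exprS; ring.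
by rewrite (funext e); apply: cvg_comp c1; apply: cvg_mulnl.
Qed.

Lemma vanishing_lin (R : realType) (f g : int -> R) (c : R) :
  vanishing f -> vanishing g -> vanishing (fun m => f m + c * g m).
Proof.
move=> [fP fN] [gP gN]; split.
  rewrite -[0](addr0 0) -[X in 0 + X](mulr0 c).
  by apply: cvgD => //; apply: cvgMl_tmp.
rewrite -[0](addr0 0) -[X in 0 + X](mulr0 c).
by apply: cvgD => //; apply: cvgMl_tmp.
Qed.

(** * The antidifference and the values L(phi_k) *)

(** Quantifying over all powers r makes the class stable under multiplication by 1 - c u, which
    raises r by one. *)
Definition decaying (R : realType) (a q : R) (f : R -> R) : Prop :=
  forall r : int, vanishing (fun m => kap a q m * uu a q m ^ r * f (uu a q m)).

Lemma decaying1 (R : realType) (a q : R) : 0 < a -> 0 < q -> q < 1 ->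
  decaying a q (fun=> 1).
Proof.
move=> a0 q0 q1 r; have := vanishing_kap_uu r a0 q0 q1.
by congr vanishing; apply/funext => m; rewrite mulr1.
Qed.

Lemma decayingM (R : realType) (a q : R) (f : R -> R) (c : R) :
  a != 0 -> q != 0 -> decaying a q f -> decaying a q (fun u => f u * (1 - c * u)).
Proof.
move=> a0 q0 df r; have := vanishing_lin (- c) (df r) (df (r + 1)).
congr vanishing; apply/funext => m.
by rewrite (expfzDr _ _ (uu_neq0 m a0 q0)) -[_ ^ 1]/(uu a q m); ring.
Qed.

(** This is (u q^(-j); q)_(2j+1), arranged around its central factor so that induction on j adds one
    factor at each end. *)
Definition midprod (R : realType) (q : R) (j : nat) (u : R) : R :=
  (1 - u) * \prod_(i < j) ((1 - q ^+ i.+1 * u) * (1 - q ^- i.+1 * u)).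

Lemma midprodS (R : realType) (q u : R) j : midprod q j.+1 u =
  midprod q j u * (1 - q ^+ j.+1 * u) * (1 - q ^- j.+1 * u).
Proof. by rewrite /midprod big_ord_recr /= !mulrA. Qed.

Lemma decaying_midprod (R : realType) (a q : R) j : 0 < a -> 0 < q -> q < 1 ->
  decaying a q (midprod q j).
Proof.
move=> a0 q0 q1; have an := lt0r_neq0 a0; have qn := lt0r_neq0 q0.
elim: j => [|j IH].
  have := decayingM 1 an qn (decaying1 a0 q0 q1); congr decaying.
  by apply/funext => u; rewrite /midprod big_ord0 mulr1 !mul1r.
have := decayingM (q ^- j.+1) an qn (decayingM (q ^+ j.+1) an qn IH).
by congr decaying; apply/funext => u; rewrite midprodS.
Qed.

(** The shift moves the window of exponents from [-j, j] to [2 - j, j + 2]: -j and 1 - j are lost, j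
    + 1 and j + 2 are gained. *)
Lemma midprod_shift (R : realType) (q u : R) j : q != 0 ->
  midprod q j (u * q ^+ 2) * (1 - u / q ^+ j) * (1 - u * q / q ^+ j) =
  midprod q j u * (1 - u * q ^+ j.+1) * (1 - u * q ^+ j.+2).
Proof.
move=> q0; elim: j => [|j IH].
  by rewrite /midprod !big_ord0 !expr0 !exprS; field.
have qj : q ^+ j != 0 by rewrite expf_neq0.
have -> : midprod q j.+1 u * (1 - u * q ^+ j.+2) * (1 - u * q ^+ j.+3) =
  (midprod q j u * (1 - u * q ^+ j.+1) * (1 - u * q ^+ j.+2)) *
  (1 - q ^- j.+1 * u) * (1 - u * q ^+ j.+3) by rewrite midprodS; ring.
by rewrite -IH midprodS !exprS; field; rewrite q0 qj.
Qed.

Lemma horner_phiS (R : realType) (q u : R) k : q != 0 -> u != 0 ->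
  (phi q k.+1).[u + u^-1] =
  (phi q k).[u + u^-1] * ((1 - q ^+ k * u) * (1 - q ^+ k / u)).
Proof.
move=> q0 u0; rewrite phiS // !hornerE /=.
move: (phi q k).[_] => P.
by field.
Qed.

(** Each 1 - q^i / u equals -(q^i / u) (1 - u / q^i). The index i = 0 yields 1 - u twice, hence the
    extra factor. *)
Lemma horner_phi_midprod (R : realType) (q u : R) j : q != 0 -> u != 0 ->
  (phi q j.+1).[u + u^-1] =
  (-1) ^+ j.+1 * q ^+ 'C(j.+1, 2) * (u ^- j.+1 * (1 - u) * midprod q j u).
Proof.
move=> q0 u0; elim: j => [|j IH].
  by rewrite horner_phiS // /phi /midprod !big_ord0 hornerC /=; field.
have qj : q ^+ j != 0 by rewrite expf_neq0.
rewrite horner_phiS // IH midprodS [in RHS]binS bin1 exprD !exprS; field.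
by rewrite q0 qj u0 expf_neq0.
Qed.

(* The antidifference of the summand is proportional to kap(m) P(u) with
   P(u) = u^(-k-1) (u q^(-k-1); q)_(2k+1): both P(u) and P(u q^2) contain the
   zeros of phi_k. For k = j + 1 the common factor is midprod j. *)
Lemma is_bilateral_sum_phi0 (R : realType) (a q : R) k :
  0 < a -> 0 < q -> q < 1 ->
  is_bilateral_sum (fun m => kap a q m * (1 + uu a q m) *
    (phi q k * ((1 + q^-1)%:P - q ^+ k *: 'X)).[uu a q m + (uu a q m)^-1]) 0.
Proof.
move=> a0 q0 q1; have an := lt0r_neq0 a0; have qn := lt0r_neq0 q0.
case: k => [|j].
  (* For k = 0 there is no middle product; the antidifference is kap(m) (1 - u / q) / u. *)
  apply: (is_bilateral_sum_telescope
      (decayingM q^-1 an qn (decaying1 a0 q0 q1) (-1))) => m.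
  have un := uu_neq0 m an qn.
  rewrite kapS // uuS // /phi big_ord0 mul1r !exprN1.
  move: (uu a q m) (kap a q m) un => u K un; rewrite !hornerE /=.
  by field; rewrite un qn.
(* The constant of [horner_phi_midprod] times the factor q^k of the term linear in y. *)
pose c := (-1) ^+ j.+1 * q ^+ 'C(j.+1, 2) * q ^+ j.+1.
pose P u := midprod q j u * (1 - q ^- j.+1 * u) * (1 - q ^- j.+2 * u).
have dP : decaying a q P.
  exact: decayingM _ an qn (decayingM _ an qn (decaying_midprod j a0 q0 q1)).
(* A zero first summand, so that [vanishing_lin] merely scales by c. *)
have d0 : vanishing (fun m => 0 * (kap a q m * uu a q m ^ 0)).
  by split; under eq_fun do rewrite mul0r; apply: cvg_cst.
apply: (is_bilateral_sum_telescope (vanishing_lin c d0 (dP (- j.+2%:Z)))) => m.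
have un := uu_neq0 m an qn.
have shift := midprod_shift (uu a q m) j qn.
rewrite kapS // uuS // !mul0r !add0r -!exprnN hornerM horner_phi_midprod //.
move: (uu a q m) (kap a q m) un shift => u K un shift; rewrite /P.
rewrite hornerD hornerN hornerC hornerZ hornerX.
have -> : midprod q j (u * q ^+ 2) * (1 - q ^- j.+1 * (u * q ^+ 2)) *
    (1 - q ^- j.+2 * (u * q ^+ 2)) =
    midprod q j u * (1 - u * q ^+ j.+1) * (1 - u * q ^+ j.+2).
  by rewrite -shift !exprS; field; rewrite qn expf_neq0.
rewrite /c exprMn -exprM [(2 * j.+2)%N]mulnC exprM.
move: (midprod q j u) ((-1) ^+ j.+1) (q ^+ 'C(j.+1, 2)) => M e b.
rewrite !exprS; field.
by rewrite qn un !expf_neq0.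
Qed.

(** Write 1 + q^(2k) - q^k y as (q^(2k) - 1/q) + (1 + 1/q - q^k y); the second part contributes 0 by
    [is_bilateral_sum_phi0]. *)
Lemma is_bilateral_sum_phi (R : realType) (a q : R) k :
  0 < a -> 0 < q -> q < 1 ->
  is_bilateral_sum (fun m => kap a q m * (1 + uu a q m) *
      (phi q k).[uu a q m + (uu a q m)^-1])
    ((- q^-1) ^+ k * qpoch q (q ^+ 2) k *
     (qpoch_inf (- a ^+ 2) q * qpoch_inf (- (q / a ^+ 2)) q * qpoch_inf q q)).
Proof.
move=> a0 q0 q1; have an := lt0r_neq0 a0; have qn := lt0r_neq0 q0.
elim: k => [|k IH].
  have := is_bilateral_sum_weight a0 q0 q1.
  rewrite expr0 qpoch0 !mul1r; congr is_bilateral_sum; apply/funext => m.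
  by rewrite /phi big_ord0 hornerC mulr1.
have := is_bilateral_sum_lin (c := q ^+ k ^+ 2 - q^-1) IH
  (is_bilateral_sum_phi0 k a0 q0 q1).
congr is_bilateral_sum; last first.
  rewrite addr0 qpochS [(- q^-1) ^+ _.+1]exprS.
  have -> : (q ^+ 2) ^+ k = q ^+ k ^+ 2 by rewrite -!exprM mulnC.
  by field.
apply/funext => m; have un := uu_neq0 m an qn.
rewrite horner_phiS //.
move: (kap a q m) (uu a q m) un => K u un; rewrite !hornerE /=.
move: (phi q k).[_] => P.
by field; rewrite un qn.
Qed.

(** The factors (-q)^k and (q; q^2)_k of [dcoef] cancel against L(phi_k), which leaves the sum of
    [sum_vfac]. *)
Lemma is_bilateral_sum_dual_qultra (R : realType) (a q : R) n :
  0 < a -> 0 < q -> q < 1 ->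
  is_bilateral_sum (fun m => kap a q m * (1 + uu a q m) *
      (dual_qultra q q^-1 n).[uu a q m + (uu a q m)^-1])
    ((n == 0)%:R *
     (qpoch_inf (- a ^+ 2) q * qpoch_inf (- (q / a ^+ 2)) q * qpoch_inf q q)).
Proof.
move=> a0 q0 q1; have qn := lt0r_neq0 q0.
set J := (_ * qpoch_inf q q).
have sum N (c : nat -> R) : is_bilateral_sum (fun m => kap a q m * (1 + uu a q m) *
    (\sum_(k < N) c k *: phi q k).[uu a q m + (uu a q m)^-1])
    (\sum_(k < N) c k * ((- q^-1) ^+ k * qpoch q (q ^+ 2) k * J)).
  elim: N => [|N IH].
    have h := is_bilateral_sum_phi (k := 0) a0 q0 q1.
    have := is_bilateral_sum_lin (c := -1) h h.
    congr is_bilateral_sum; last by rewrite big_ord0 mulN1r addNr.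
    apply/funext => m.
    by rewrite big_ord0 horner0 mulr0 mulN1r addNr.
  have := is_bilateral_sum_lin (c := c N) (is_bilateral_sum_phi (k := N) a0 q0 q1) IH.
  congr is_bilateral_sum; last by rewrite [RHS]big_ord_recr addrC.
  by apply/funext => m; rewrite big_ord_recr /= hornerD hornerZ; ring.
rewrite (dual_qultraE qn (leqnn n)).
have := sum n.+1 (fun k => vfac (q ^+ n) q k * dcoef q k).
congr is_bilateral_sum.
transitivity ((\sum_(k < n.+1) vfac (q ^+ n) q k / qpoch q q k) * J).
  rewrite mulr_suml; apply: eq_bigr => k _; rewrite !mulrA; congr (_ * _).
  have nz1 m := subr1X_neq0 m q0 q1.
  have nz2 := qpoch_sqr_neq0 k q0 q1.
  have nz3 := qpoch_neq0 k q0 q1.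
  have e : (- q) ^+ k * (- q^-1) ^+ k = 1.
    by rewrite -exprMn mulrNN divff // expr1n.
  rewrite /dcoef -[RHS]mul1r -e; field.
  by rewrite nz2 nz3.
rewrite sum_vfac //; congr (_ * _).
case: n {sum} => [|n]; first by rewrite big_ord0.
by rewrite big_ord_recr /= subrr mul0r mulr0.
Qed.

(** * Orthogonality of the D_k on the lattice y_m *)

Theorem mainTheorem2 (R : realType) (q a : R)
    (hq0 : 0 < q) (hq1 : q < 1) (hqa : q <= a) (ha1 : a < 1) (k k' : nat) :
  let y (m : int) : R := a ^ (- 2) * q ^ (- (2 * m)) + a ^ 2 * q ^ (2 * m) in
  is_bilateral_sum
    (fun m : int =>
       a ^ (4 * m + 1) * q ^ (2 * m ^+ 2) * (a^-1 * q ^ (- m) + a * q ^ m)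
       * (dual_qultra q q^-1 k).[y m] * (dual_qultra q q^-1 k').[y m])
    (qpoch_inf (- a ^+ 2) q * qpoch_inf (- (q / a ^+ 2)) q * qpoch_inf q q
     * qpoch q q (2 * k) / (q ^+ k * qpoch q (q ^+ 2) k ^+ 2)
     * (k == k')%:R).
Proof.
move=> y; have a0 : 0 < a by apply: lt_le_trans hqa.
have an := lt0r_neq0 a0; have qn := lt0r_neq0 hq0.
set J := (_ * qpoch_inf q q).
pose L (p : {poly R}) (v : R) := is_bilateral_sum (fun m => kap a q m *
  (1 + uu a q m) * p.[uu a q m + (uu a q m)^-1]) v.
pose h n := J * qpoch q q (2 * n) / (q ^+ n * qpoch q (q ^+ 2) n ^+ 2).
have nz m := subr1X_neq0 m hq0 hq1.
have Llin c p v p' v' : L p v -> L p' v' -> L (c *: p + p') (c * v + v').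
  move=> Lp Lp'; have := is_bilateral_sum_lin (c := c) Lp Lp'.
  congr is_bilateral_sum; apply/funext => m.
  by rewrite hornerD hornerZ; ring.
have A0 n : 1 - (q * q ^+ n ^+ 2)^-1 != 0.
  rewrite -exprM -exprS subr_eq0 -[1]invr1 (inj_eq invr_inj) eq_sym.
  by rewrite -subr_eq0 -oppr_eq0 opprB.
have C0 : 1 - (q ^+ 0 ^+ 2)^-1 = 0 by rewrite expr0 expr1n invr1 subrr.
(* Both ratios equal (1 - q^(2n+2)) / (q (1 - q^(2n+1))). *)
have hrec n : (1 - (q ^+ n.+1 ^+ 2)^-1) * h n = (1 - (q * q ^+ n ^+ 2)^-1) * h n.+1.
  rewrite /h mulnS !qpochS -!exprS.
  have -> : (q ^+ 2) ^+ n = q ^+ n ^+ 2 by rewrite -!exprM mulnC.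
  have nz2 := qpoch_sqr_neq0 n hq0 hq1.
  have -> : q ^+ (2 * n).+2 = q ^+ n.+1 ^+ 2 by rewrite -exprM; congr (_ ^+ _); lia.
  have := nz (2 * n)%N.
  have -> : q ^+ (2 * n).+1 = q * q ^+ n ^+ 2 by rewrite exprS -exprM mulnC.
  move=> nz3; rewrite [q ^+ n.+1]exprS; field.
  by rewrite qn nz2 nz3 expf_neq0.
have D0 : dual_qultra q q^-1 0 = 1.
  rewrite (dual_qultraE qn (leqnn 0)) big_ord1.
  by rewrite /vfac /dcoef /phi !qpoch0 !big_ord0 expr0 !mul1r invr1 scale1r.
have base n : L (dual_qultra q q^-1 n) (h n * (n == 0)%:R).
  have := is_bilateral_sum_dual_qultra (n := n) a0 hq0 hq1.
  congr is_bilateral_sum; case: n => [|n]; last by rewrite mul0r mulr0.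
  by rewrite /h muln0 !qpoch0 expr0 expr1n !mulr1 mul1r invr1 mulr1.
have := orthogonal_of_recurrence Llin A0 C0
  (fun n => dual_qultra_recurrence n hq0 hq1) hrec D0 base k k'.
congr is_bilateral_sum; apply/funext => m.
have yE : y m = uu a q m + (uu a q m)^-1.
  by rewrite /y /uu invfM !invr_expz addrC.
rewrite yE hornerM mulrA; congr (_ * _ * _).
(* With z = a q^m, 1/z + z = (1 + z^2) / z, and division by z turns the prefactor into kap(m). *)
rewrite /kap /uu (expfzDr (4 * m)%Z 1%Z an) (expfzDr (2 * m ^+ 2) _ qn) -[a ^ 1%Z]/a.
have -> : q ^ (2 * m) = q ^ m * q ^ m by rewrite -expfzDr //; congr (_ ^ _); ring.
rewrite -invr_expz; field.
by rewrite an expfz_neq0.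
Qed.
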